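(* Let $M=(E,\mathcal{I})$ be a loopless matroid on a finite set $E$ with rank function $r$, and let $c=(c_1,\dots,c_m)$ be a sequence of integers with $m\ge 2$ and $0\le c_1<c_2<\dots<c_m\le r(E)$. Then the cardinality constrained matroid polytope $P_{\mathcal{I}}^c(E)$ is completely described by the following system, i.e. $P_{\mathcal{I}}^c(E)$ equals the set of all $x\in\mathbb{R}^E$ satisfying \begin{align*} &(c_{p+1}-r(F))\,x(F)-(r(F)-c_p)\,x(E\setminus F)\le c_p\,(c_{p+1}-r(F)) && \text{for all } F\subseteq E \text{ with } c_p<r(F)<c_{p+1} \text{ for some } p\in\{1,\dots,m-1\},\\ &x(E)\ge c_1,\\ &x(E)\le c_m,\\ &x(F)\le r(F) && \text{for all } \emptyset\ne F\subseteq E,\\ &x_e\ge 0 && \text{for all } e\in E. \end{align*}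
   Context: A loop of a matroid is an element $e\in E$ such that $\{e\}$ is dependent; loopless means there are no loops. For $x\in\mathbb{R}^E$ and $S\subseteq E$, $x(S):=\sum_{e\in S}x_e$. For $I\subseteq E$, $\chi^I\in\{0,1\}^E$ is its incidence vector. The cardinality constrained matroid polytope is $P_{\mathcal{I}}^c(E):=\operatorname{conv}\{\chi^I : I\in\mathcal{I},\ |I|=c_p \text{ for some } p\in\{1,\dots,m\}\}$. *)

(* Defs.v *)
From mathcomp Require Import all_boot all_order all_algebra.
From mathcomp Require Import boolp classical_sets reals convex.

Set Implicit Arguments.
Unset Strict Implicit.
Unset Printing Implicit Defensive.

Import Order.TTheory GRing.Theory Num.Theory.

Record matroid (E : finType) := Matroid {
  indep : {set {set E}};
  indep0 : finset.set0 \in indep;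
  indepS : forall I J : {set E}, J \subset I -> I \in indep -> J \in indep;
  indep_aug : forall I J : {set E}, I \in indep -> J \in indep ->
    (#|I| < #|J|)%N -> exists2 e, e \in J :\: I & e |: I \in indep
}.

Section Matroid.
Variables (E : finType) (M : matroid E).

Definition rank (F : {set E}) : nat :=
  (\max_(I in indep M | I \subset F) #|I|)%N.

Definition loop (e : E) : bool := [set e] \notin indep M.

Definition loopless : Prop := forall e : E, ~~ loop e.

End Matroid.

Local Open Scope ring_scope.
Local Open Scope classical_set_scope.

Definition convex_hull (R : numDomainType) (V : lmodType R) (A : set V) :
  set V := smallest (@convex_set R V) A.

Section Polytope.
Variables (R : realType) (E : finType).

(* R^E is {ffun E -> R^o}: the regular module R^o, convertible to R, is what
   gives it its lmodType R structure. *)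
Definition vsum (x : {ffun E -> R^o}) (S : {set E}) : R :=
  \sum_(e in S) (x e : R).

Definition incidence (I : {set E}) : {ffun E -> R^o} :=
  [ffun e => (e \in I)%:R].

Definition cc_polytope (M : matroid E) (c : seq nat) : set {ffun E -> R^o} :=
  convex_hull [set incidence I | I in [set I | I \in indep M /\ #|I| \in c]].

End Polytope.

Arguments cc_polytope R {E} M c.

(* Main.v *)
From mathcomp Require Import boolp classical_sets reals.
From mathcomp Require Import interval_inference convex.
From mathcomp Require Import all_boot all_order all_algebra.
Require Import Defs.
From mathcomp Require Import lra ring zify.

Set Implicit Arguments.
Unset Strict Implicit.
Unset Printing Implicit Defensive.

Import Order.TTheory GRing.Theory Num.Theory.
Local Open Scope ring_scope.

(** That the polytope satisfies the system is a check on incidence vectors.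
Conversely let [x] satisfy the system and put [t = x(E)].  Some consecutive
pair [k = c_p < k' = c_(p+1)] has [k <= t <= k'].  Write [r] for the rank and
let [f] be the convex combination of the truncated ranks [min(r, k)] and
[min(r, k')] that takes the value [t] at [E]:

  [(k' - k) f = (k' - t) min(r, k) + (t - k) min(r, k')].

The point of the system is that it amounts to [x(F) <= f(F)] for every [F]:
this is [x(F) <= r(F)] when [r(F) <= k], it follows from [x >= 0] and
[x(E) = t] when [k' <= r(F)], and it is the cardinality inequality, rearranged
with [x(E \ F) = t - x(F)], in between.

By Farkas' lemma, [x] is in the hull of finitely many points as soon as every
linear functional [w] is at least as large at one of the points as at [x]
([mem_convex_hull]).  Given [w], order [E] by decreasing [w] and let [S_i] be
the first [i] elements.  The greedy algorithm ([chain_basis]), run in the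
truncations of the matroid at [k] and at [k'], gives independent sets [I] of
size [k] and [J] of size [k'] meeting every [S_i] in [min(r(S_i), k)] and
[min(r(S_i), k')] elements.  So the combination [y] of their incidence vectors
with the weights used for [f] has [y(S_i) = f(S_i) >= x(S_i)] and
[y(E) = x(E)], and summation by parts ([greedy_chain]) gives [w.x <= w.y].
Hence [w] is at least as large at [I] or at [J] as at [x]
([two_level_support]). *)

(** * Farkas' lemma and membership in a convex hull *)

Section Dot.
Variables (R : realFieldType) (T : finType).
Implicit Types a b y : {ffun T -> R^o}.

Definition dot a y : R := \sum_t a t * y t.

Lemma dotDl a b y : dot (a + b) y = dot a y + dot b y.
Proof.
by rewrite /dot -big_split /=; apply: eq_bigr => t _; rewrite ffunE mulrDl.
Qed.

Lemma dotZl (k : R) a y : dot (k *: a) y = k * dot a y.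
Proof.
by rewrite /dot mulr_sumr; apply: eq_bigr => t _; rewrite ffunE mulrA.
Qed.

Lemma dotC a y : dot a y = dot y a.
Proof. by apply: eq_bigr => t _; rewrite mulrC. Qed.

Lemma dotBl a b y : dot (a - b) y = dot a y - dot b y.
Proof. by rewrite -scaleN1r dotDl dotZl mulN1r. Qed.

Lemma dotBr a y z : dot a (y - z) = dot a y - dot a z.
Proof. by rewrite dotC dotBl !(dotC a). Qed.

Lemma dotZr (k : R) a y : dot a (k *: y) = k * dot a y.
Proof. by rewrite dotC dotZl dotC. Qed.

Lemma dot_self_le0 a : dot a a <= 0 -> a = 0.
Proof.
move=> a_le0; have a_sq t : true -> 0 <= a t * a t by rewrite -expr2 sqr_ge0.
apply/ffunP => t; rewrite ffunE; apply/eqP.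
rewrite -[_ == _]orbb -mulf_eq0.
suff /psumr_eq0P-/(_ a_sq)-> : dot a a = 0 by [].
by apply/eqP; rewrite eq_le a_le0 sumr_ge0.
Qed.

(** Bartl's induction on the number of vectors.  If [b] is not already forced
by the others, some [y0] violates [b] while satisfying them, so
[dot (a k) y0 > 0].  Subtracting multiples of [a k] makes every vector vanish
at [y0] ([q] gives the multiples); the modified [b] is then a combination of
the modified vectors, and the sign conditions at [y0] make the resulting
coefficient of [a k] nonnegative. *)
Lemma farkas (I : eqType) (s : seq I) (a : I -> {ffun T -> R^o}) b :
    uniq s ->
    (forall y, (forall i, i \in s -> dot (a i) y <= 0) -> dot b y <= 0) ->
  exists2 l : I -> R, forall i, 0 <= l i & b = \sum_(i <- s) l i *: a i.
Proof.
elim: s a b => [|k s IHs] a b.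
  move=> _ b_le0; exists (fun=> 0) => //.
  by rewrite big_nil; apply: dot_self_le0; apply: b_le0.
move=> /andP[kNs s_uniq] b_le0.
case: (EM (forall y, (forall i, i \in s -> dot (a i) y <= 0) -> dot b y <= 0)).
  move=> /(IHs _ _ s_uniq)[l l_ge0 ->].
  exists (fun i => if i == k then 0 else l i) => [i|]; first by case: ifP.
  rewrite big_cons eqxx scale0r add0r; apply: eq_big_seq => i i_s.
  by case: eqP i_s kNs => // -> ->.
move=> /existsNP[y0 /not_implyP[s_y0 /negP]]; rewrite -ltNge => b_y0.
have k_y0 : 0 < dot (a k) y0.
  rewrite ltNge; apply: contraL b_y0; rewrite -leNgt => k_y0.
  by apply: b_le0 => i /predU1P[->//|/s_y0].
pose q v := dot v y0 / dot (a k) y0.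
have [y s_y|l l_ge0 bE] :=
    IHs (fun i => a i - q (a i) *: a k) (b - q b *: a k) s_uniq.
  (* Moving [y] along [y0] onto the kernel of [a k] leaves the modified
     functionals unchanged. *)
  pose z := y - (dot (a k) y / dot (a k) y0) *: y0.
  have zE v : dot (v - q v *: a k) y = dot v z.
    by rewrite dotBl dotZl dotBr dotZr /q; ring.
  rewrite zE; apply: b_le0 => i /predU1P[->|/s_y]; last by rewrite zE.
  by rewrite dotBr dotZr divfK ?gt_eqF// subrr.
exists (fun i => if i == k then q b - \sum_(j <- s) l j * q (a j) else l i).
  move=> i; case: ifP => // _; rewrite subr_ge0.
  apply: (@le_trans _ _ 0); last by rewrite divr_ge0 ?ltW.
  rewrite big_seq sumr_le0 // => j j_s; rewrite mulr_ge0_le0 //.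
  by rewrite mulr_le0_ge0 ?s_y0 // invr_ge0 ltW.
rewrite big_cons eqxx -[LHS](subrK (q b *: a k)) bE scalerBl.
rewrite [X in _ = _ + X](_ : _ = \sum_(i <- s) l i *: a i); last first.
  by apply: eq_big_seq => i i_s; case: eqP i_s kNs => // -> ->.
rewrite scaler_suml addrC -addrA; congr (_ + _).
rewrite addrC -sumrB; apply: eq_bigr => i _.
by rewrite scalerBr scalerA.
Qed.
End Dot.

Lemma convex_set_sum (R : realFieldType) (V : lmodType R) (C : set V)
    (I : eqType) (s : seq I) (l : I -> R) (a : I -> V) :
    convex_set C -> (forall i, 0 <= l i) -> (forall i, i \in s -> C (a i)) ->
    \sum_(i <- s) l i = 1 ->
  C (\sum_(i <- s) l i *: a i).
Proof.
move=> C_conv l_ge0 Ca l_sum1.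
(* For the induction the weights are only assumed to have a positive sum. *)
suff C_avg : 0 < \sum_(i <- s) l i ->
    C ((\sum_(i <- s) l i)^-1 *: \sum_(i <- s) l i *: a i).
  by move: C_avg; rewrite l_sum1 invr1 scale1r; apply.
elim: s Ca {l_sum1} => [|k s IHs] Ca; first by rewrite big_nil ltxx.
rewrite !big_cons; set S := \sum_(i <- s) l i; set v := \sum_(i <- s) _ *: _.
have S_ge0 : 0 <= S by apply: sumr_ge0.
have Ck : C (a k) by apply: Ca; rewrite mem_head.
move=> tot_gt0; have [S0|S_neq0] := eqVneq S 0.
  have -> : v = 0.
    rewrite /v big_seq big1 // => i i_s.
    move/eqP: S0; rewrite psumr_eq0 // => /allP/(_ _ i_s)/eqP->.
    by rewrite scale0r.
  move: tot_gt0; rewrite S0 !addr0 => lk_gt0.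
  by rewrite scalerA mulVf ?scale1r// gt_eqF.
have S_gt0 : 0 < S by rewrite lt_def S_neq0.
have Cv : C (S^-1 *: v).
  by apply: IHs => // i i_s; apply: Ca; rewrite inE i_s orbT.
have t_ge0 : 0 <= l k / (l k + S) by rewrite divr_ge0 // ltW.
have t_le1 : l k / (l k + S) <= 1 by rewrite ler_pdivrMr // mul1r lerDl.
have := C_conv (a k) (S^-1 *: v) (Itv01 t_ge0 t_le1).
move=> /(_ (mem_set Ck) (mem_set Cv))/set_mem; congr (C _).
rewrite /conv /= /unstable.onem scalerDr !scalerA; congr (_ *: _ + _ *: _).
  by rewrite mulrC.
have tot_neq0 : l k + S != 0 by rewrite gt_eqF.
by field; rewrite tot_neq0 S_neq0.
Qed.

(** Homogenisation: giving every point an extra coordinate 1, indexed by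
[None], turns conic combinations of the lifted points into convex combinations
of the points, and linear functionals on the lifted space into affine ones. *)
Lemma mem_convex_hull (R : realType) (E I : finType) (P : pred I)
    (a : I -> {ffun E -> R^o}) (A : set {ffun E -> R^o}) x :
    (forall i, P i -> A (a i)) ->
    (forall w, exists2 i, P i & dot x w <= dot (a i) w) ->
  convex_hull A x.
Proof.
move=> Aa x_le C [C_conv AC].
pose lift (v : {ffun E -> R^o}) : {ffun option E -> R^o} :=
  [ffun o => if o is Some e then v e else 1].
have dot_lift v y :
    dot (lift v) y = dot v [ffun e => y (Some e)] + y None.
  (* [option E] is enumerated as [None] followed by the image of [Some]. *)
  rewrite /dot ![index_enum _]unlock /= {1}[Finite.enum]unlock /=.
  rewrite big_cons big_map !ffunE mul1r addrC; congr (_ + _).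
  by apply: eq_bigr => e _; rewrite !ffunE.
have [y a_y|l l_ge0 xE] :=
    @farkas _ _ _ (enum P) (fun i => lift (a i)) (lift x) (enum_uniq _).
  have [i Pi xi] := x_le [ffun e => y (Some e)].
  apply: le_trans (a_y i _); last by rewrite mem_enum.
  by rewrite !dot_lift lerD2r.
have l_sum1 : \sum_(i <- enum P) l i = 1.
  have /ffunP/(_ None) := xE; rewrite sum_ffunE ffunE => ->.
  by apply: eq_bigr => i _; rewrite !ffunE; apply/esym/mulr1.
have -> : x = \sum_(i <- enum P) l i *: a i.
  apply/ffunP => e; have /ffunP/(_ (Some e)) := xE.
  rewrite !sum_ffunE ffunE => ->.
  by apply: eq_bigr => i _; rewrite !ffunE.
by apply: convex_set_sum => // i; rewrite mem_enum => /Aa /AC.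
Qed.

(** * Bases adapted to a chain *)

Section MatroidRank.
Variables (E : finType) (M : matroid E).
Implicit Types (F I J : {set E}) (S : nat -> {set E}).

Lemma card_indep_le I F : I \in indep M -> I \subset F -> (#|I| <= rank M F)%N.
Proof.
move=> I_ind IF.
by apply: (@leq_bigmax_cond _ _ (fun J : {set E} => #|J|) I); rewrite I_ind.
Qed.

Lemma basis_exists F :
  exists I, [/\ I \in indep M, I \subset F & #|I| = rank M F].
Proof.
have [|I /andP[I_ind IF] rk] := @eq_bigmax_cond _
  [pred I : {set E} | (I \in indep M) && (I \subset F)] (fun I => #|I|).
  by apply/card_gt0P; exists set0; rewrite inE indep0 sub0set.
by exists I.
Qed.

Lemma basis_extend I F : I \in indep M -> I \subset F ->
  exists J, [/\ J \in indep M, I \subset J, J \subset F & #|J| = rank M F].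
Proof.
have [n] := ubnP (rank M F - #|I|)%N; elim: n I => // n IHn I lt_n I_ind IF.
have := card_indep_le I_ind IF; rewrite leq_eqVlt => /predU1P[rkI|ltI].
  by exists I; split.
have [B [B_ind BF rkB]] := basis_exists F.
have [|e /setDP[eB eNI] eI_ind] := indep_aug I_ind B_ind; first by rewrite rkB.
have [|//||J [J_ind eIJ JF rkJ]] := IHn (e |: I).
- by rewrite cardsU1 eNI; lia.
- by rewrite subUset sub1set (subsetP BF) ?eB.
by exists J; split => //; apply: subset_trans eIJ; apply: subsetUr.
Qed.

(** The greedy algorithm: extending a basis of [S i] to one of [S i.+1] keeps
its trace on the earlier sets, because a trace, being independent, cannot
exceed the rank. *)
Lemma chain_basis S n : (forall i, S i \subset S i.+1) ->
  exists2 I, I \in indep M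
    & forall i, (i <= n)%N -> #|I :&: S i| = rank M (S i).
Proof.
move=> S_mono; suff [I [I_ind _ I_S]] : exists I,
    [/\ I \in indep M, I \subset S n
      & forall i, (i <= n)%N -> #|I :&: S i| = rank M (S i)] by exists I.
elim: n => [|n [I [I_ind IS rkI]]].
  have [I [I_ind IS rkI]] := basis_exists (S 0%N).
  exists I; split => // i; rewrite leqn0 => /eqP->.
  by rewrite (setIidPl IS).
have [J [J_ind IJ JS rkJ]] := basis_extend I_ind (subset_trans IS (S_mono n)).
exists J; split => // i; rewrite leq_eqVlt => /predU1P[->|].
  by rewrite (setIidPl JS).
rewrite ltnS => i_le_n; apply/eqP; rewrite eqn_leq; apply/andP; split.
  by apply: card_indep_le (subsetIr _ _); apply: indepS J_ind; apply: subsetIl.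
by rewrite -rkI // subset_leq_card // setSI.
Qed.
End MatroidRank.

Section Truncation.
Variables (E : finType) (M : matroid E) (k : nat).

Definition trunc_indep : {set {set E}} := [set I in indep M | #|I| <= k]%N.

Lemma trunc_indep0 : set0 \in trunc_indep.
Proof. by rewrite inE indep0 cards0. Qed.

Lemma trunc_indepS (I J : {set E}) :
  J \subset I -> I \in trunc_indep -> J \in trunc_indep.
Proof.
rewrite !inE => JI /andP[I_ind Ik]; rewrite (indepS JI I_ind).
exact: leq_trans (subset_leq_card JI) Ik.
Qed.

Lemma trunc_indep_aug (I J : {set E}) :
  I \in trunc_indep -> J \in trunc_indep ->
  (#|I| < #|J|)%N -> exists2 e, e \in J :\: I & e |: I \in trunc_indep.
Proof.
rewrite !inE => /andP[I_ind _] /andP[J_ind Jk] IJ.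
have [e eJI eI_ind] := indep_aug I_ind J_ind IJ; exists e => //.
rewrite inE eI_ind /= cardsU1; apply: leq_trans Jk.
by case: (e \notin I) => //=; apply: ltnW.
Qed.

Definition truncation := Matroid trunc_indep0 trunc_indepS trunc_indep_aug.

Lemma rank_truncation F : rank truncation F = minn (rank M F) k.
Proof.
apply/eqP; rewrite eqn_leq; apply/andP; split.
  apply/bigmax_leqP => I; rewrite inE -andbA => /and3P[I_ind Ik IF].
  by rewrite leq_min Ik card_indep_le.
have [B [B_ind BF <-]] := basis_exists M F.
have /card_geqP[s [s_uniq s_size sB]] := geq_minl #|B| k.
have sB' : [set e in s] \subset B by apply/subsetP => e; rewrite inE => /sB.
have card_s : #|[set e in s]| = minn #|B| k.
  by rewrite cardsE (card_uniqP s_uniq).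
rewrite -card_s; apply: card_indep_le; last exact: subset_trans BF.
by rewrite inE (indepS sB' B_ind) card_s geq_minr.
Qed.
End Truncation.

(** * Support functions and the greedy algorithm *)

(** Summation by parts, arranged for induction at the right end: the last
element, having the least weight, is the bound for the elements before it. *)
Lemma abel_le (R : realDomainType) (I : Type) (s : seq I)
    (w d : I -> R) b :
    pairwise (fun e f => w f <= w e) s ->
    (forall i, 0 <= \sum_(e <- take i s) d e) -> all (fun e => b <= w e) s ->
  b * (\sum_(e <- s) d e) <= \sum_(e <- s) w e * d e.
Proof.
move: b; elim/last_ind: s => [|s f IHs] b.
  by move=> _ _ _; rewrite !big_nil mulr0.
rewrite pairwise_rcons all_rcons => /andP[s_f s_pw] d_ge0 /andP[b_f _].
have := d_ge0 (size (rcons s f)); rewrite take_size => D_ge0.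
apply: (@le_trans _ _ (w f * \sum_(e <- rcons s f) d e)).
  exact: ler_wpM2r.
rewrite !big_rcons /= mulrDr lerD2r.
apply: IHs => // i; have [i_le|i_gt] := leqP i (size s).
  by have := d_ge0 i; rewrite -cats1 takel_cat.
rewrite take_oversize ?(ltnW i_gt)//.
by have := d_ge0 (size s); rewrite -cats1 take_size_cat.
Qed.

Section Vsum.
Variables (R : realType) (E : finType).
Implicit Types (x w : {ffun E -> R^o}) (F I : {set E}).

Lemma vsum_dot x F : vsum x F = dot x (incidence R F).
Proof.
rewrite /vsum /dot big_mkcond; apply: eq_bigr => e _; rewrite ffunE.
by case: ifP => _; [rewrite mulr1|rewrite mulr0].
Qed.

Lemma vsum_incidence I F : vsum (incidence R I) F = #|I :&: F|%:R.
Proof.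
rewrite /vsum -sum1_card natr_sum big_mkcond [RHS]big_mkcond.
by apply: eq_bigr => e _; rewrite ffunE inE andbC; do 2!case: (_ \in _).
Qed.

Lemma vsum_ge0 x F : (forall e, 0 <= (x e : R)) -> 0 <= vsum x F.
Proof. by move=> x_ge0; apply: sumr_ge0. Qed.

Lemma vsum_setC x F : vsum x F + vsum x (~: F) = vsum x setT.
Proof.
rewrite /vsum [RHS](bigID (mem F)) /=; congr (_ + _); apply: eq_bigl => e.
  by rewrite inE.
by rewrite !inE.
Qed.

(** [S i] consists of the [i] elements of largest weight, so that
[d] having nonnegative sums over every [S i] is the dominance condition under
which summation by parts bounds [dot d w]. *)
Lemma greedy_chain w : exists S : nat -> {set E},
  [/\ forall i, S i \subset S i.+1, S #|E| = setT
    & forall d, (forall i, (i <= #|E|)%N -> 0 <= vsum d (S i)) ->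
        vsum d setT = 0 -> 0 <= dot d w].
Proof.
pose s := sort (fun e f => w f <= w e) (enum E).
have s_uniq : uniq s by rewrite sort_uniq enum_uniq.
have mem_s e : e \in s by rewrite mem_sort mem_enum.
have size_s : size s = #|E| by rewrite size_sort -cardE.
have s_pw : pairwise (fun e f => w f <= w e) s.
  rewrite -sorted_pairwise; last by move=> f e g /= ef fg; apply: le_trans ef.
  by apply: sort_sorted => e f; apply: le_total.
have sum_s i d : vsum d [set e in take i s] = \sum_(e <- take i s) d e.
  rewrite /vsum big_uniq ?take_uniq //=; apply: eq_bigl => e.
  by rewrite inE.
exists (fun i => [set e in take i s]); split.
- move=> i; apply/subsetP => e; rewrite !inE.
  by rewrite -[take i s](@take_takel _ i i.+1) // => /mem_take.
- by apply/setP => e; rewrite !inE -size_s take_size mem_s.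
move=> d d_ge0 d_tot.
have sE (f : E -> R) : \sum_e f e = \sum_(e <- s) f e.
  by rewrite [RHS]big_uniq //=; apply: eq_bigl => e; rewrite mem_s.
rewrite dotC /dot sE.
have d_sum0 : \sum_(e <- s) d e = 0.
  by rewrite -sE -[RHS]d_tot /vsum; apply: eq_bigl => e; rewrite inE.
(* The total of [d] is 0, so any lower bound [b] of the weights will do. *)
have [b b_w] : exists b : R, all (fun e => b <= w e) s.
  case E_s: s => [|e t]; first by exists 0.
  exists (w (last e t)); rewrite -E_s; apply/allP => f.
  move: s_pw; rewrite E_s lastI pairwise_rcons => /andP[/allP/= le_last _].
  by rewrite mem_rcons inE => /predU1P[->|/le_last].
have := @abel_le R _ s w d b s_pw; rewrite d_sum0 mulr0.
apply=> // i; rewrite -sum_s.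
have [/d_ge0//|i_gt] := leqP i #|E|.
rewrite take_oversize ?size_s; last exact: ltnW.
by have := d_ge0 _ (leqnn _); rewrite -size_s take_size.
Qed.

(** The heart of the proof: a point between two consecutive cardinalities
never beats both greedy solutions.  The vector [d] below is the difference
[y - x] multiplied by [k' - k]. *)
Lemma two_level_support (M : matroid E) (k k' : nat) x w :
    (k < k' <= rank M setT)%N -> (forall e, 0 <= (x e : R)) ->
    k%:R <= vsum x setT <= k'%:R ->
    (forall F, vsum x F <= (rank M F)%:R) ->
    (forall F, (k < rank M F < k')%N ->
      (k'%:R - (rank M F)%:R) * vsum x F
        - ((rank M F)%:R - k%:R) * vsum x (~: F)
      <= k%:R * (k'%:R - (rank M F)%:R)) ->
  exists2 I, (I \in indep M) && (#|I| \in [:: k; k'])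
    & dot x w <= dot (incidence R I) w.
Proof.
move=> /andP[lt_kk' k'_rk] x_ge0 /andP[k_le le_k'] x_rk x_mid.
have [S [S_mono S_top S_dot]] := greedy_chain w.
have basis n : (n <= rank M setT)%N -> exists I, [/\ I \in indep M, #|I| = n
    & forall i, (i <= #|E|)%N -> #|I :&: S i| = minn (rank M (S i)) n].
  move=> n_le; have [I] := chain_basis (truncation M n) #|E| S_mono.
  rewrite inE => /andP[I_ind _] I_S; exists I; split => // [|i /I_S->].
    have := I_S _ (leqnn _).
    by rewrite S_top setIT rank_truncation (minn_idPr n_le).
  exact: rank_truncation.
have [I [I_ind card_I I_S]] := basis _ (leq_trans (ltnW lt_kk') k'_rk).
have [J [J_ind card_J J_S]] := basis _ k'_rk.
set t := vsum x setT in k_le le_k'.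
pose d := (k'%:R - t) *: incidence R I + (t - k%:R) *: incidence R J
          - (k'%:R - k%:R) *: x.
have vsum_d F : vsum d F = (k'%:R - t) * #|I :&: F|%:R
    + (t - k%:R) * #|J :&: F|%:R - (k'%:R - k%:R) * vsum x F.
  by rewrite vsum_dot dotBl dotDl !dotZl -!vsum_dot !vsum_incidence.
have kk'R : k%:R < k'%:R :> R by rewrite ltr_nat.
have : 0 <= dot d w.
  apply: S_dot => [i /[dup] /I_S I_i /J_S J_i|]; last first.
    by rewrite vsum_d !setIT card_I card_J -/t; ring.
  rewrite vsum_d I_i J_i; move: (S i) => F {I_i J_i}.
  have xFC := vsum_setC x F; have xC_ge0 := vsum_ge0 (~: F) x_ge0.
  rewrite -/t in xFC; have xF := x_rk F.
  (* The three ranges of [rank M F] use [x_rk], [x_mid] and [xC_ge0]. *)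
  have [rk_k|k_rk] := leqP (rank M F) k.
    rewrite (minn_idPl (leq_trans rk_k (ltnW lt_kk'))).
    nra.
  have [rk_k'|k'_rkF] := ltnP (rank M F) k'.
    have := x_mid F; rewrite k_rk rk_k' => /(_ isT).
    have -> : vsum x (~: F) = t - vsum x F by rewrite -xFC; ring.
    lra.
  nra.
rewrite dotBl dotDl !dotZl => w_ge0.
have [I_le|I_gt] := leP (dot x w) (dot (incidence R I) w).
  by exists I => //; rewrite I_ind card_I !inE eqxx.
have [J_le|J_gt] := leP (dot x w) (dot (incidence R J) w).
  by exists J => //; rewrite J_ind card_J !inE eqxx orbT.
have t_lo : 0 <= t - k%:R by rewrite subr_ge0.
have t_hi : 0 <= k'%:R - t by rewrite subr_ge0.
suff : (k'%:R - t) * dot (incidence R I) w + (t - k%:R) * dot (incidence R J) w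
    < (k'%:R - k%:R) * dot x w by rewrite ltNge -subr_ge0 w_ge0.
rewrite [X in _ < X](_ : _ = (k'%:R - t) * dot x w + (t - k%:R) * dot x w);
  last by ring.
have [k_t|t_k] := ltP k%:R t.
  by rewrite ler_ltD ?ler_wpM2l ?ltr_pM2l ?subr_gt0 // ltW.
rewrite ltr_leD ?ler_wpM2l ?ltr_pM2l ?subr_gt0 ?(le_lt_trans t_k) //.
exact: ltW.
Qed.
End Vsum.

(** * The cardinality constrained matroid polytope *)

Lemma between_consecutive d (T : orderType d) (u : nat -> T) n t :
  (u 0%N <= t <= u n.+1)%O -> exists2 p, (p <= n)%N & (u p <= t <= u p.+1)%O.
Proof.
elim: n => [|n IHn]; first by exists 0%N.
move=> /andP[u_t t_u]; have [le_t|/ltW ge_t] := leP t (u n.+1).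
  by have [|p /leqW] := IHn _; [rewrite u_t|exists p].
by exists n.+1; rewrite ?ge_t.
Qed.

Local Open Scope classical_set_scope.

(* c_(p+1) is nth 0%N c p: tuples are indexed from 0. *)
Theorem theorem2p1 (R : realType) (E : finType) (M : matroid E)
    (m : nat) (c : m.-tuple nat) :
  loopless M ->
  (2 <= m)%N ->
  sorted ltn c ->
  (nth 0%N c m.-1 <= rank M finset.setT)%N ->
  cc_polytope R M c =
  [set x : {ffun E -> R^o} |
    [/\ forall (F : {set E}) (p : nat), (p.+1 < m)%N ->
          (nth 0%N c p < rank M F < nth 0%N c p.+1)%N ->
          ((nth 0%N c p.+1)%:R - (rank M F)%:R) * vsum x F
            - ((rank M F)%:R - (nth 0%N c p)%:R) * vsum x (~: F)
          <= (nth 0%N c p)%:R * ((nth 0%N c p.+1)%:R - (rank M F)%:R),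
        (nth 0%N c 0)%:R <= vsum x finset.setT,
        vsum x finset.setT <= (nth 0%N c m.-1)%:R,
        forall F : {set E}, F != finset.set0 -> vsum x F <= (rank M F)%:R
      & forall e : E, (0 : R) <= x e]].
Proof.
move=> _ m_ge2 c_sorted c_rk.
have c_lt p q : (p < q < m)%N -> (nth 0%N c p < nth 0%N c q)%N.
  move=> /andP[pq qm]; apply: (sorted_ltn_nth ltn_trans) => //;
    rewrite ?inE ?size_tuple//.
  exact: ltn_trans qm.
have c_le p q : (p <= q < m)%N -> (nth 0%N c p <= nth 0%N c q)%N.
  by case: (ltngtP p q) => //= [pq qm|-> //]; apply/ltnW/c_lt; rewrite pq.
apply/seteqP; split=> [|x [x_mid x_lo x_hi x_rk x_ge0]]; last first.
  have x_rk' F : vsum x F <= (rank M F)%:R.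
    have [->|/x_rk//] := eqVneq F finset.set0.
    by rewrite /vsum finset.big_set0 ler0n.
  have [|p p_le x_p] := @between_consecutive _ R
    (fun p => (nth 0%N c p)%:R) m.-2 (vsum x finset.setT).
    (* [2 <= m] makes [m.-2.+1] the last index. *)
    by rewrite x_lo; have -> : m.-2.+1 = m.-1 by lia.
  have p_lt : (p.+1 < m)%N by lia.
  apply: (@mem_convex_hull _ _ _ (fun I => (I \in indep M) && (#|I| \in c))
    (@incidence R E)).
    by move=> I /andP[I_ind I_c]; exists I.
  move=> w; have [|I] :=
    two_level_support w _ x_ge0 x_p x_rk' (fun F => x_mid F p p_lt).
    by rewrite c_lt ?p_lt ?ltnSn //=; apply: leq_trans c_rk; apply: c_le; lia.
  move=> /andP[I_ind I_c] xI; exists I => //; rewrite I_ind /=.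
  move: I_c; rewrite !inE => /orP[]/eqP->; apply: mem_nth;
    by rewrite size_tuple // ltnW.
apply: smallest_sub.
  move=> x y l /set_mem[x1 x2 x3 x4 x5] /set_mem[y1 y2 y3 y4 y5].
  apply: mem_set.
  have l0 : 0 <= l%:num :> R by [].
  have l1 : 0 <= 1 - l%:num :> R by rewrite subr_ge0.
  have vE F : vsum (conv l x y) F =
      l%:num * vsum x F + (1 - l%:num) * vsum y F.
    by rewrite /conv /= !vsum_dot dotDl !dotZl.
  split => [F p p_lt rF||| F F0|e]; rewrite ?vE.
  - have := x1 F p p_lt rF; have := y1 F p p_lt rF; nra.
  - nra.
  - nra.
  - have := x4 F F0; have := y4 F F0; nra.
  by rewrite !ffunE addr_ge0 // mulr_ge0.
move=> _ [I [I_ind I_c] <-] /=.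
have /(nthP 0%N)[q] := I_c; rewrite size_tuple => q_lt card_I.
split => [F p p_lt /andP[rk_lo rk_hi]||| F _|e].
- rewrite !vsum_incidence.
  have IF_rk : (#|I :&: F| <= rank M F)%N.
    apply: card_indep_le (subsetIr _ _).
    by apply: indepS I_ind; apply: subsetIl.
  have := cardsID F I; rewrite finset.setDE -card_I => card_split.
  move: #|I :&: F| #|I :&: ~: F| (rank M F) IF_rk rk_lo rk_hi card_split.
  move=> i j r; rewrite -!(ltr_nat R) -(ler_nat R) => i_r r_lo r_hi ij.
  have j_ge0 : 0 <= j%:R :> R by [].
  (* With [i = |I n F|] and [j = |I \ F|]: a set of size at most [c_p] has
     [i <= c_p], any other one has [c_(p+1) <= i + j]. *)
  have [q_p|p_q] := leqP q p.
    have : (i <= nth 0%N c p)%N.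
      by apply: leq_trans (leq_addr j i) _; rewrite ij c_le ?q_p //= ltnW.
    rewrite -(ler_nat R); nra.
  have : (nth 0%N c p.+1 <= i + j)%N by rewrite ij c_le ?p_q.
  rewrite -(ler_nat R) natrD; nra.
- by rewrite vsum_incidence finset.setIT -card_I ler_nat c_le.
- by rewrite vsum_incidence finset.setIT -card_I ler_nat c_le //; lia.
- rewrite vsum_incidence ler_nat card_indep_le ?finset.subsetIr //.
  by apply: indepS I_ind; apply: finset.subsetIl.
by rewrite ffunE ler0n.
Qed.
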